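(* Let $(G,\zeta)_\xi$ be a soft topological group with group operation $\ast$, and let $H$ and $K$ be soft connected subsets of $G$. Then $H\ast K=\{h\ast k: h\in H,\ k\in K\}\subseteq G$ is also soft connected.
   Context: A soft set over a set $X$ with parameter set $\xi$ is a function $W\colon\xi\to\mathcal{P}(X)$. Soft union, soft intersection and soft inclusion $\widetilde{\sqsubseteq}$ of soft sets with parameter set $\xi$ are taken parameterwise. For $A\subseteq X$, the absolute soft subset $A_\xi$ is the soft set with $A_\xi(e)=A$ for all $e\in\xi$; in particular $\emptyset_\xi$ and $X_\xi$. For $x\in X$, $x\,\widetilde{\in}\,W$ means $x\in W(e)$ for every $e\in\xi$. A soft topology $\zeta$ on $X$ with parameter set $\xi$ is a collection of soft sets over $X$ (with parameter set $\xi$) containing $\emptyset_\xi$ and $X_\xi$ and closed under arbitrary soft unions and under soft intersections of two members; members of $\zeta$ are soft open. A soft open neighborhood of $x$ is a $W\in\zeta$ with $x\,\widetilde{\in}\,W$. For nonempty $A\subseteq X$, the soft subspace $(A,\zeta_A)_\xi$ has $\zeta_A=\{W_A:W\in\zeta\}$, $W_A(e)=W(e)\cap A$. A function $\varrho\colon X\to X'$ gives a soft continuous mapping $(\mathbb{I}_\xi,\varrho)\colon(X,\zeta)_\xi\to(X',\zeta')_\xi$ if for every $x\in X$ and every soft open neighborhood $W'$ of $\varrho(x)$ there is a soft open neighborhood $W$ of $x$ with $\varrho(W)\,\widetilde{\sqsubseteq}\,W'$, where $\varrho(W)(e)=\varrho(W(e))$. A soft topological group $(G,\zeta)_\xi$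 is a group $(G,\ast)$ with a soft topology $\zeta$ on $G$ with parameter set $\xi$ such that (i) for all $(a,b)\in G\times G$ and every soft open neighborhood $W$ of $a\ast b$ there are soft open neighborhoods $U$ of $a$ and $V$ of $b$ with $U\ast V\,\widetilde{\sqsubseteq}\,W$, where $(U\ast V)(e)=U(e)\ast V(e)$; and (ii) the inversion $\iota(a)=a^{-1}$ gives a soft continuous mapping $(\mathbb{I}_\xi,\iota)$ from $(G,\zeta)_\xi$ to itself. $(X,\zeta)_\xi$ is soft disconnected if there are nonempty $A,B\subseteq X$ with $A\cup B=X$, $A\cap B=\emptyset$ and both $A_\xi$ and $B_\xi$ soft open; otherwise it is soft connected. A subset $A\subseteq X$ is soft connected if $(A,\zeta_A)_\xi$ is soft connected. *)

(* Defs.v *)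
From HB Require Import structures.
From mathcomp Require Import all_boot.
From mathcomp Require Import boolp classical_sets functions.

Set Implicit Arguments.
Unset Strict Implicit.
Unset Printing Implicit Defensive.

Local Open Scope classical_set_scope.

(* The carrier of a soft space is a set X : set T, so that a subset A of X
   carries its soft subspace literally, with W_A e = W e `&` A. *)

Section SoftSets.
Variables (xi T : Type).

Definition softset := xi -> set T.

Definition soft_abs (A : set T) : softset := fun=> A.

Definition soft_bigcup (F : set softset) : softset :=
  fun e => \bigcup_(W in F) W e.

Definition soft_setI (V W : softset) : softset := fun e => V e `&` W e.

Definition soft_subset (V W : softset) : Prop := forall e, V e `<=` W e.

Definition soft_in (x : T) (W : softset) : Prop := forall e, W e x.

Record soft_topology (X : set T) (zeta : set softset) : Prop := SoftTopology {
  soft_open_sub : forall W, zeta W -> soft_subset W (soft_abs X);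
  soft_open0 : zeta (soft_abs set0);
  soft_openT : zeta (soft_abs X);
  soft_open_bigcup : forall F, F `<=` zeta -> zeta (soft_bigcup F);
  soft_openI : forall V W, zeta V -> zeta W -> zeta (soft_setI V W)
}.

Definition soft_open_nbhd (zeta : set softset) (x : T) (W : softset) : Prop :=
  zeta W /\ soft_in x W.

Definition soft_subspace (zeta : set softset) (A : set T) : set softset :=
  [set soft_setI W (soft_abs A) | W in zeta].

Definition soft_disconnected (X : set T) (zeta : set softset) : Prop :=
  exists A B : set T,
    [/\ A `<=` X, B `<=` X, A !=set0 & B !=set0] /\
    [/\ A `|` B = X, A `&` B = set0, zeta (soft_abs A) & zeta (soft_abs B)].

Definition soft_connected (X : set T) (zeta : set softset) : Prop :=
  ~ soft_disconnected X zeta.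

(* No nonemptiness is imposed on A: the empty set is vacuously connected. *)
Definition soft_connected_subset (zeta : set softset) (A : set T) : Prop :=
  soft_connected A (soft_subspace zeta A).

Lemma soft_subspace_topology (X : set T) (zeta : set softset) (A : set T) :
  soft_topology X zeta -> A `<=` X -> soft_topology A (soft_subspace zeta A).
Proof.
move=> [_ z0 zX zU zI] AX; split.
- by move=> _ [W _ <-] e x [].
- exists (soft_abs set0) => //.
  by apply/funext => e; rewrite /soft_setI /soft_abs set0I.
- exists (soft_abs X) => //.
  by apply/funext => e; rewrite /soft_setI /soft_abs setIC; apply/setIidPl.
- move=> F FA.
  exists (soft_bigcup [set W | zeta W /\ F (soft_setI W (soft_abs A))]).
    by apply: zU => W [].
  apply/funext => e; apply/seteqP; split => x.
    by move=> [[W [_ FW] Wx] Ax]; exists (soft_setI W (soft_abs A)).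
  move=> [V FV]; have [W zW WV] := FA V FV; rewrite -WV => -[Wx Ax].
  by split=> //; exists W => //; split=> //; rewrite WV.
- move=> _ _ [V zV <-] [W zW <-]; exists (soft_setI V W); first exact: zI.
  by apply/funext => e; rewrite /soft_setI /soft_abs setIACA setIid.
Qed.

End SoftSets.

Definition soft_image (xi T T' : Type) (rho : T -> T') (W : softset xi T) :
  softset xi T' := fun e => rho @` W e.

Definition soft_continuous (xi T T' : Type)
    (X : set T) (zeta : set (softset xi T))
    (X' : set T') (zeta' : set (softset xi T')) (rho : T -> T') : Prop :=
  set_fun X X' rho /\
  forall x, X x -> forall W', soft_open_nbhd zeta' (rho x) W' ->
    exists2 W, soft_open_nbhd zeta x W & soft_subset (soft_image rho W) W'.

Definition set_mulg (G : groupType) (A B : set G) : set G :=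
  [set (a * b)%g | a in A & b in B].

Definition soft_mulg (xi : Type) (G : groupType) (U V : softset xi G) :
  softset xi G := fun e => set_mulg (U e) (V e).

Record soft_topological_group (xi : Type) (G : groupType)
    (zeta : set (softset xi G)) : Prop := SoftTopologicalGroup {
  stg_topology : soft_topology [set: G] zeta;
  stg_mul : forall (a b : G) W, soft_open_nbhd zeta (a * b)%g W ->
    exists U V, [/\ soft_open_nbhd zeta a U, soft_open_nbhd zeta b V &
                    soft_subset (soft_mulg U V) W];
  stg_inv : soft_continuous [set: G] zeta [set: G] zeta (fun a : G => a^-1%g)
}.

(* Main.v *)
Require Import Defs.
From mathcomp Require Import all_boot.
From mathcomp Require Import boolp classical_sets functions.

(** The classical argument that avoids product spaces. Left translation by
    a fixed [h] and right translation by a fixed [k] are soft continuous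
    ([soft_continuous_mulgl], [soft_continuous_mulgr]), and a soft continuous map
    cannot send a soft connected set to both sides of a separation
    ([soft_connected_one_side]). Given a separation [A], [B] of [H * K] with
    [h1 k1] in [A] and [h2 k2] in [B], translating by [h1] forces [h1 k2] into
    [A], and translating by [k2] then forces [h2 k2] into [A], a contradiction.

    Softness causes no trouble because the pieces of a separation are absolute
    soft sets: a point of [A] lies in every parameter slice of the open soft set
    cutting out [A], so that soft set is a soft open neighborhood of the point,
    and all the neighborhoods are then compared slice by slice. *)

Local Open Scope classical_set_scope.

(** The union of all soft open sets whose trace on [A] lies in [S] has trace
    exactly [S]: the local hypothesis puts each point of [S] in every slice of
    the union. *)
Lemma soft_subspace_open_abs {xi T : Type} {X : set T}
    {zeta : set (softset xi T)} {A S : set T} :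
  soft_topology X zeta -> S `<=` A ->
  (forall x, S x -> exists2 V, soft_open_nbhd zeta x V &
     soft_subset (soft_setI V (soft_abs A)) (soft_abs S)) ->
  soft_subspace zeta A (soft_abs S).
Proof.
move=> zT SA locS.
exists (soft_bigcup [set V | zeta V /\
    soft_subset (soft_setI V (soft_abs A)) (soft_abs S)]).
  by apply: (soft_open_bigcup zT) => V [].
apply/funext => e; apply/seteqP; split=> x.
  by move=> [[V [_ VS] Vx] Ax]; apply: (VS e).
move=> Sx; split; last exact: SA.
by have [V [zV xV] VS] := locS x Sx; exists V => //; apply: xV.
Qed.

Lemma soft_subspace_preimage {xi T T' : Type} {X : set T} {X' : set T'}
    {zeta : set (softset xi T)} {zeta' : set (softset xi T')}
    {rho : T -> T'} {A : set T} {Y S : set T'} :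
  soft_topology X zeta -> soft_continuous X zeta X' zeta' rho ->
  A `<=` X -> rho @` A `<=` Y -> soft_subspace zeta' Y (soft_abs S) ->
  soft_subspace zeta A (soft_abs (A `&` rho @^-1` S)).
Proof.
move=> zT [_ rho_cont] AX rhoAY [W' zW' W'S].
have W'E e : W' e `&` Y = S by exact: (congr1 (fun F => F e) W'S).
apply: (soft_subspace_open_abs zT) => [x []//|x [Ax Sx]].
have nW' : soft_open_nbhd zeta' (rho x) W'.
  by split=> // e; have : S (rho x) by []; rewrite -(W'E e) => -[].
have [W nW rhoWW'] := rho_cont x (AX x Ax) W' nW'.
exists W => // e y [Wy Ay]; split=> //=.
rewrite -(W'E e); split; first by apply: (rhoWW' e); exists y.
by apply: rhoAY; exists y.
Qed.

(** Otherwise the preimages of the two pieces would separate [A]. *)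
Lemma soft_connected_one_side {xi T T' : Type} {X : set T} {X' : set T'}
    {zeta : set (softset xi T)} {zeta' : set (softset xi T')}
    {rho : T -> T'} {A : set T} {Y C D : set T'} (x y : T) :
  soft_topology X zeta -> soft_continuous X zeta X' zeta' rho ->
  A `<=` X -> rho @` A `<=` Y -> soft_connected_subset zeta A ->
  C `|` D = Y -> C `&` D = set0 ->
  soft_subspace zeta' Y (soft_abs C) ->
  soft_subspace zeta' Y (soft_abs D) ->
  A x -> A y -> C (rho x) -> C (rho y).
Proof.
move=> zT rho_cont AX rhoAY cA CDY CD0 oC oD Ax Ay Cx.
apply: contrapT => nCy; apply: cA.
have CDrho z : A z -> (C `|` D) (rho z).
  by move=> Az; rewrite CDY; apply: rhoAY; exists z.
exists (A `&` rho @^-1` C), (A `&` rho @^-1` D); split; split.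
- by move=> z [].
- by move=> z [].
- by exists x.
- by exists y; split=> //; case: (CDrho y Ay).
- by rewrite -setIUr -preimage_setU; apply/setIidPl => z; apply: CDrho.
- by rewrite -setIIr -preimage_setI CD0 preimage_set0 setI0.
- exact: soft_subspace_preimage zT rho_cont AX rhoAY oC.
- exact: soft_subspace_preimage zT rho_cont AX rhoAY oD.
Qed.

Lemma soft_continuous_mulgl {xi : Type} {G : groupType}
    {zeta : set (softset xi G)} (h : G) : soft_topological_group zeta ->
  soft_continuous [set: G] zeta [set: G] zeta (fun k => (h * k)%g).
Proof.
move=> hG; split=> // k _ W nW.
have [U [V [[_ hU] nV UVW]]] := stg_mul hG nW.
exists V => // e _ [y Vy <-]; apply: (UVW e).
by exists h; [exact: hU | exists y].
Qed.

Lemma soft_continuous_mulgr {xi : Type} {G : groupType}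
    {zeta : set (softset xi G)} (k : G) : soft_topological_group zeta ->
  soft_continuous [set: G] zeta [set: G] zeta (fun h => (h * k)%g).
Proof.
move=> hG; split=> // h _ W nW.
have [U [V [nU [_ kV] UVW]]] := stg_mul hG nW.
exists U => // e _ [y Uy <-]; apply: (UVW e).
by exists y => //; exists k => //; exact: kV.
Qed.

Theorem proposition5p8 (xi : Type) (G : groupType)
    (zeta : set (softset xi G)) (hG : soft_topological_group zeta)
    (H K : set G) (hH : soft_connected_subset zeta H)
    (hK : soft_connected_subset zeta K) :
  soft_connected_subset zeta (set_mulg H K).
Proof.
move=> [A [B [[AHK BHK [a Aa] [b Bb]] [ABE AB0 oA oB]]]].
have [h1 Hh1 [k1 Kk1 ha]] := AHK a Aa.
have [h2 Hh2 [k2 Kk2 hb]] := BHK b Bb.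
have zT := stg_topology hG.
have Ah1k2 : A (h1 * k2)%g.
  apply: (soft_connected_one_side k1 k2 zT
    (soft_continuous_mulgl h1 hG) (@subsetT _ K) _ hK ABE AB0 oA oB) => //.
    by move=> _ [k Kk <-]; exists h1 => //; exists k.
  by rewrite ha.
have Ab : A b.
  rewrite -hb; apply: (soft_connected_one_side h1 h2 zT
    (soft_continuous_mulgr k2 hG) (@subsetT _ H) _ hH ABE AB0 oA oB) => //.
  by move=> _ [h Hh <-]; exists h => //; exists k2.
by have : (A `&` B) b by []; rewrite AB0.
Qed.
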